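(* Let $G$ be a cop-win graph on $n\geq 7$ vertices, let $Z\subseteq V(G)$ be the set of vertices $v$ such that a single cop starting at $v$ can guarantee capturing a single robber (who chooses his start after the cop) by round $n-4$, and let $$d_Z=\max\{d(x,Z)\mid x\in N[u],\ u\in V(G)\text{ is a trap}\}.$$ Then for every $m\geq 1$, $\mathrm{capt}(G,m)\leq d_Z(m-1)+m(n-4)$.
   Context: All graphs are finite, simple, connected and reflexive (every vertex is considered adjacent to itself, so a player may stay in place). The game of $k$ cops and $m$ robbers on $G$: in round 0 the cops first choose starting vertices, then the robbers choose theirs. In each round $i\geq 1$, all $k$ cops move (each to an adjacent vertex or staying), then all $m$ robbers move likewise. Several players may occupy the same vertex. Whenever a cop and some robbers occupy the same vertex, those robbers are captured and take no further part in the game. Both sides have full information. The cops win if all robbers are captured after finitely many rounds. $G$ is $k$-cop-win if $k$ cops can always win against one robber (cop-win means $1$-cop-win). For a $k$-cop-win graph $G$ and $\ell\geq k$, $\mathrm{capt}_\ell(G,m)$ is the index of the round in which the last robber is captured when $\ell$ cops play to minimize this index and $m$ robbers play to maximize it; $\mathrm{capt}(G,m)=\mathrm{capt}_1(G,m)$. A vertex $u$ is a trap if $N[u]\subseteq N[v]$ for some vertex $v\neq u$. $d(x,Z)=\min_{z\in Z}d(x,z)$. (It is known that every cop-win graph on $n\geq 7$ vertices has capture time at most $n-4$ against one robber, so $Z\neq\emptyset$.) *)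

(* Defs.v *)
(* Cops and robbers on a finite simple connected graph,
   given as a symmetric irreflexive relation e on a finType T. *)
From mathcomp Require Import all_boot.
Set Implicit Arguments. Unset Strict Implicit. Unset Printing Implicit Defensive.

Section CopsRobbers.
Variables (T : finType) (e : rel T).

(* reflexive adjacency: a player may stay in place *)
Definition adj (x y : T) : bool := (x == y) || e x y.

Definition cnbhd (u : T) : {set T} := [set v | adj u v].

Definition is_trap (u : T) : bool :=
  [exists v, (v != u) && (cnbhd u \subset cnbhd v)].

Fixpoint nball (k : nat) (x : T) : {set T} :=
  if k is k'.+1 then \bigcup_(y in nball k' x) cnbhd y else [set x].

(* d(x,Z) = least k such that some z in Z is within distance k of x.
   In a connected graph on #|T| vertices every distance is < #|T|, so the
   search over 0..#|T|-1 is exhaustive (for nonempty Z). *)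
Definition distZ (x : T) (Z : {set T}) : nat :=
  find (fun k => [exists z in Z, z \in nball k x]) (iota 0 #|T|).

(* Game states: cops' positions (a seq of vertices), robbers' states
   (Some v = active at v, None = captured). *)
Definition capture (C : seq T) (R : seq (option T)) : seq (option T) :=
  map (fun r => if r is Some v then (if v \in C then None else Some v) else None) R.

Definition allcap (R : seq (option T)) : bool := all (fun r => r == None) R.

Definition cmoves (C C' : seq T) : bool := all2 adj C C'.

Definition rmoves (R R' : seq (option T)) : bool :=
  all2 (fun r r' => match r, r' with
                    | Some a, Some b => adj a b
                    | None, None => true
                    | _, _ => false end) R R'.

(* win s C R : at the end of a round, with cops at C and robbers in state R,
   the cops can force capture of all robbers within the next s rounds
   (each round: all cops move, captures, all robbers move, captures). *)
Fixpoint win (s : nat) (C : seq T) (R : seq (option T)) : Prop :=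
  allcap R \/
  match s with
  | 0 => False
  | s'.+1 => exists C', cmoves C C' /\
              (allcap (capture C' R) \/
               forall R', rmoves (capture C' R) R' -> win s' C' (capture C' R'))
  end.

(* k cops can guarantee that all m robbers are captured by round t:
   round 0: cops place, then robbers place (knowing cops' positions). *)
Definition cops_win_by (k m t : nat) : Prop :=
  exists C : k.-tuple T, forall R : m.-tuple T,
    win t C (capture C (map Some R)).

Definition cop_start_win_by (v : T) (t : nat) : Prop :=
  forall r : T, win t [:: v] (capture [:: v] [:: Some r]).

Definition k_cop_win (k : nat) : Prop := exists t, cops_win_by k 1 t.
Definition cop_win : Prop := k_cop_win 1.

Definition is_capt (k m c : nat) : Prop :=
  cops_win_by k m c /\ forall t, cops_win_by k m t -> c <= t.

End CopsRobbers.

(* Main.v *)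
Require Import Defs.
From mathcomp Require Import all_boot.
From mathcomp Require Import zify.
From Stdlib Require Import Classical.
Set Implicit Arguments. Unset Strict Implicit. Unset Printing Implicit Defensive.

(* The cop catches the robbers one after the other, each time from a vertex of
   Z, which is nonempty by Gavenciak's theorem. Suppose that the robber at r is
   to move, that the cop is at c <> r and that she wins within k more rounds.
   If N[r] is not contained in N[c], the robber can step outside N[c] and keep
   doing so until he sits on a trap, which he reaches after at most k - 1 steps.
   So wherever he goes from r, even if he walks into the cop, he ends at
   distance at most d_Z + k - 1 from Z. If he is caught there right away, k - 1
   rounds of this chase are unused, and together with the d_Z rounds allowed
   between two chases they bring the cop back to Z. *)

(** * One cop against one robber, and removal of a trap *)

Section OneRobber.
Variables (T : eqType) (a : rel T).

(* The cop at c, who is to move, can catch the robber at r within k rounds in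
   the subgraph induced on s. *)
Fixpoint catches (s : seq T) (k : nat) (c r : T) : bool :=
  (c == r) ||
  if k is k'.+1 then
    has (fun c' => a c c' &&
           ((c' == r) || all (fun r' => a r r' ==> catches s k' c' r') s)) s
  else false.

Definition capt_le (s : seq T) (k : nat) : bool :=
  has (fun c => all (catches s k c) s) s.

Lemma catchesSP s k c r :
  reflect (c = r \/ exists c', [/\ c' \in s, a c c' &
             c' = r \/ forall r', r' \in s -> a r r' -> catches s k c' r'])
          (catches s k.+1 c r).
Proof.
apply: (iffP orP) => -[/eqP->|h]; [by left| |by left; apply/eqP|]; right.
  have /hasP[c' sc' /andP[ac h']] := h; exists c'; split=> //.
  case/orP: h' => [/eqP->|/allP h']; [by left|right] => r' sr' ar.
  by have /implyP := h' _ sr'; apply.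
have [c' [sc' ac h']] := h; apply/hasP; exists c' => //; rewrite ac /=.
case: h' => [->|h']; apply/orP; [by left; apply/eqP|right].
by apply/allP => r' sr'; apply/implyP; apply: h'.
Qed.

Lemma catches0 s c r : catches s 0 c r = (c == r).
Proof. by rewrite /= orbF. Qed.

Lemma catches_refl s k c : catches s k c c.
Proof. by case: k => [|k] /=; rewrite eqxx. Qed.

Lemma catchesS s k c r : catches s k c r -> catches s k.+1 c r.
Proof.
elim: k c r => [|k IH] c r; first by rewrite catches0 => /eqP->; apply: catches_refl.
case/catchesSP => [->|[c' [sc' ac h]]]; first exact: catches_refl.
apply/catchesSP; right; exists c'; split=> //.
by case: h => [->|h]; [left|right=> r' sr' ar; apply/IH/h].
Qed.

Lemma capt_le_mem s k :
  reflect (exists2 c, c \in s & forall r, r \in s -> catches s k c r) (capt_le s k).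
Proof.
apply: (iffP hasP) => -[c sc h]; exists c => //; last by apply/allP.
by move=> r sr; apply: (allP h).
Qed.

Section Retract.
Hypotheses (a_refl : reflexive a) (a_sym : symmetric a).
Variables (u v : T) (s' s : seq T).
Hypotheses (sE : s =i u :: s') (us' : u \notin s') (vs' : v \in s').
Hypothesis uv : forall w, w \in s -> a u w -> a v w.

Let fold_corner x := if x == u then v else x.

Let fold_in x : x \in s -> fold_corner x \in s'.
Proof. by rewrite sE inE /fold_corner; case: eqP. Qed.

Let sub x : x \in s' -> x \in s.
Proof. by move=> xs; rewrite sE inE xs orbT. Qed.

Let fold_id x : x \in s' -> fold_corner x = x.
Proof. by rewrite /fold_corner; case: eqP => // -> uin; case/negP: us'. Qed.

Let fold_adj_l x y : x \in s -> y \in s -> a x y -> a (fold_corner x) y.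
Proof. by move=> xs ys; rewrite /fold_corner; case: eqP => // -> /uv; apply. Qed.

Let fold_adj x y : x \in s -> y \in s -> a x y -> a (fold_corner x) (fold_corner y).
Proof.
move=> xs ys /(fold_adj_l xs ys); rewrite a_sym => h; rewrite a_sym.
by apply: fold_adj_l => //; apply/sub/fold_in.
Qed.

(** The cop plays the image of her strategy under the retraction [fold_corner], which sends the
    corner [u] to [v]; a robber confined to [s'] is his own image. *)
Let catches_fold k c r : c \in s -> r \in s' ->
  catches s k c r -> catches s' k (fold_corner c) r.
Proof.
elim: k c r => [|k IH] c r cs rs; first by rewrite /= !orbF => /eqP->; rewrite fold_id.
case/catchesSP => [->|[c' [sc' ac h]]]; first by rewrite fold_id // catches_refl.
apply/catchesSP; right; exists (fold_corner c').
split; [exact: fold_in|exact: fold_adj|].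
case: h => [->|h]; [by left; apply: fold_id|right=> r' rs' ar].
by apply: IH => //; apply: h => //; apply: sub.
Qed.

Lemma capt_le_retract k : capt_le s k -> capt_le s' k.
Proof.
case/capt_le_mem=> c cs h; apply/capt_le_mem; exists (fold_corner c); first exact: fold_in.
by move=> r rs; apply: catches_fold => //; apply/h/sub.
Qed.

(** The cop chases the robber's image in [s']. Once she stands on it she is adjacent to him, as [v]
    is adjacent to all of N[u], and one more round suffices. *)
Let catches_unfold k c r : c \in s' -> r \in s ->
  catches s' k c (fold_corner r) -> catches s k.+1 c r.
Proof.
have caught n x : x \in s -> catches s n.+1 (fold_corner x) x.
  move=> xs; apply/catchesSP; right; exists x; split=> //; last by left.
  exact: fold_adj_l.
elim: k c r => [|k IH] c r cs rs; first by rewrite catches0 => /eqP->; apply: caught.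
case/catchesSP => [->|[c' [sc' ac h]]]; first exact: caught.
apply/catchesSP; right; exists c'; split; [exact: sub|by []|right=> r' rs' ar].
(* Standing on the image of [r], the cop is adjacent to every [r'] the robber can move to. *)
case: h => [->|h].
  apply/catchesSP; right; exists r'; split=> //; [exact: fold_adj_l|by left].
by apply: IH => //; apply: h; [apply: fold_in|apply: fold_adj].
Qed.

Lemma capt_le_extend k : capt_le s' k -> capt_le s k.+1.
Proof.
case/capt_le_mem=> c cs h; apply/capt_le_mem; exists c; first exact: sub.
by move=> r rs; apply: catches_unfold => //; apply/h/fold_in.
Qed.

End Retract.

(** While N[r] is not inside N[c], the robber escapes to some [y] outside N[c]; the cop's answer
    cannot land on [y], and a round is used up. With no round left he could simply stay,
    uncaught. *)
Lemma catches_trap s k c r : reflexive a -> c \in s -> r \in s -> c <> r ->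
  (forall r', r' \in s -> a r r' -> catches s k c r') ->
  exists u v, [/\ u \in s, v \in s, v != u & forall w, w \in s -> a u w -> a v w].
Proof.
move=> a_refl; elim: k c r => [|k IH] c r cs rs cr h.
  by case: cr; apply/eqP; have := h _ rs (a_refl r); rewrite /= orbF.
have [dom|] := boolP (all (fun w => a r w ==> a c w) s).
  exists r, c; split=> //; first exact/eqP.
  by move=> w ws; apply/implyP; apply: (allP dom).
case/allPn=> y ys; rewrite negb_imply => /andP[ary acy].
case/catchesSP: (h _ ys ary) => [cy|[c' [c's acc' [c'y|h']]]].
- by rewrite cy a_refl in acy.
- by rewrite -c'y acc' in acy.
by apply: (IH c' y) => // c'y; rewrite -c'y acc' in acy.
Qed.

(** If N[c] is everything, any other vertex is a trap dominated by [c]. Otherwise the robber starts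
    outside N[c], and after the cop's first move [catches_trap] applies. *)
Lemma capt_le_trap s k : reflexive a -> uniq s -> 1 < size s -> capt_le s k ->
  exists u v, [/\ u \in s, v \in s, v != u & forall w, w \in s -> a u w -> a v w].
Proof.
move=> a_refl us ss /capt_le_mem[c cs h].
have [r rs cr] : exists2 r, r \in s & r != c.
  case: s us ss cs {h} => [//|x [//|y s]] /= /andP[xys _] _ _.
  have xy: y != x by apply: contraNneq xys => ->; rewrite inE eqxx.
  have [<-|] := eqVneq x c; first by exists y; rewrite // !inE eqxx orbT.
  by exists x; rewrite // inE eqxx.
have [/allP dom|/allPn[y ys acy]] := boolP (all (a c) s).
  by exists r, c; split=> //; [rewrite eq_sym|move=> w ws _; apply: dom].
case: k h => [|k] h; first by have := h _ ys; rewrite /= orbF => /eqP cy; rewrite cy a_refl in acy.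
case/catchesSP: (h _ ys) => [cy|[c' [c's acc' [c'y|h']]]].
- by rewrite cy a_refl in acy.
- by rewrite -c'y acc' in acy.
by apply: (catches_trap a_refl c's ys _ h') => c'y; rewrite -c'y acc' in acy.
Qed.

End OneRobber.

Lemma catches_map (T U : eqType) (a : rel T) (b : rel U) (f : U -> T) s s' k :
  s =i map f s' ->
  {in s' &, forall x y, b x y = a (f x) (f y)} ->
  {in s' &, forall c r, catches b s' k c r -> catches a s k (f c) (f r)}.
Proof.
move=> sE fE; elim: k => [|k IH] c r cs rs.
  by rewrite /= !orbF => /eqP->.
case/catchesSP => [->|[c' [c's acc' h]]]; first exact: catches_refl.
apply/catchesSP; right; exists (f c').
rewrite sE map_f // -fE //; split=> //.
case: h => [->|h]; [by left|right=> y].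
by rewrite sE => /mapP[r' r's ->]; rewrite -fE // => ar; apply: IH => //; apply: h.
Qed.

(** Used with [id] to pass from the code of a graph to the graph, and with the map from indices to
    vertices in a dismantling order. *)
Lemma capt_le_map (T U : eqType) (a : rel T) (b : rel U) (f : U -> T) s s' k :
  s =i map f s' ->
  {in s' &, forall x y, b x y = a (f x) (f y)} ->
  capt_le b s' k -> capt_le a s k.
Proof.
move=> sE fE /capt_le_mem[c cs h]; apply/capt_le_mem; exists (f c).
  by rewrite sE map_f.
move=> y; rewrite sE => /mapP[r rs ->].
by apply: (catches_map sE fE) => //; apply: h.
Qed.

(** * Exhaustive check of the dismantlable graphs on seven vertices *)

Section SmallGraphs.

Fixpoint bitseqs n : seq bitseq :=
  if n is n'.+1 then [seq x :: r | x <- [:: true; false], r <- bitseqs n'] else [:: [::]].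

Lemma mem_bitseqs r : r \in bitseqs (size r).
Proof. by elim: r => // x r IH; apply/allpairsP; exists (x, r); case: x. Qed.

(** [M] holds the adjacency matrix below its diagonal, row [i] having [i] entries, so that adding a
    vertex appends one row. *)
Definition of_rows (M : seq bitseq) : rel nat := fun i j =>
  if i == j then true
  else if j < i then nth false (nth [::] M i) j else nth false (nth [::] M j) i.

Definition rows (b : rel nat) n : seq bitseq :=
  [seq [seq b i j | j <- iota 0 i] | i <- iota 0 n].

(* Versions of has, all and catches that stay lazy under vm_compute, which
   evaluates both arguments of && and ||. *)
Fixpoint any (p : pred nat) s := if s is x :: s' then if p x then true else any p s' else false.
Fixpoint every (p : pred nat) s := if s is x :: s' then if p x then every p s' else false else true.

Lemma anyE p s : any p s = has p s.
Proof. by elim: s => //= x s ->; case: (p x). Qed.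
Lemma everyE p s : every p s = all p s.
Proof. by elim: s => //= x s ->; case: (p x). Qed.

Fixpoint fast_catches (a : rel nat) (s : seq nat) k c r : bool :=
  if c == r then true else
  if k is k'.+1 then
    any (fun c' => if a c c' then
           if c' == r then true
           else every (fun r' => if a r r' then fast_catches a s k' c' r' else true) s
         else false) s
  else false.

Lemma fast_catchesE a s k c r : fast_catches a s k c r = catches a s k c r.
Proof.
elim: k c r => [|k IH] c r /=; first by case: eqP.
case: eqP => //= _; rewrite anyE; apply: eq_has => c'.
case: (a c c') => //=; case: eqP => //= _; rewrite everyE; apply: eq_all => r'.
by rewrite IH; case: (a r r').
Qed.

Definition fast_capt_le a s k := any (fun c => every (fast_catches a s k c) s) s.

Lemma fast_capt_leE a s k : fast_capt_le a s k = capt_le a s k.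
Proof.
rewrite /fast_capt_le anyE; apply: eq_has => c; rewrite everyE.
by apply: eq_all => r; apply: fast_catchesE.
Qed.

Definition last_dominated (a : rel nat) n :=
  any (fun d => every (fun w => if a n w then a d w else true) (iota 0 n.+1)) (iota 0 n).

(* Codes of all dismantling orders of n vertices none of whose prefixes of
   length l > 4 has capture time at most l - 4. *)
Fixpoint slow_codes n : seq (seq bitseq) :=
  if n is n'.+1 then
    [seq M <- [seq rcons M r | M <- slow_codes n', r <- bitseqs n'] |
      if (if n' is 0 then true else last_dominated (of_rows M) n')
      then if n <= 4 then true else ~~ fast_capt_le (of_rows M) (iota 0 n) (n - 4)
      else false]
  else [:: [::]].

(** Pruning after each new vertex keeps the computation small. Emptiness means that every
    dismantling order of seven vertices has a prefix of some length [l > 4] with capture time at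
    most [l - 4]. *)
Lemma slow_codes7 : slow_codes 7 = [::].
Proof. by vm_compute. Qed.

Lemma iota_rcons n : iota 0 n.+1 = rcons (iota 0 n) n.
Proof. by rewrite -addn1 iotaD cats1. Qed.

Lemma rowsS b n : rows b n.+1 = rcons (rows b n) [seq b n j | j <- iota 0 n].
Proof. by rewrite /rows iota_rcons map_rcons. Qed.

Lemma of_rowsE b n i j : reflexive b -> symmetric b -> i < n -> j < n ->
  of_rows (rows b n) i j = b i j.
Proof.
move=> b_refl b_sym iN jN; rewrite /of_rows.
have nthE k l : k < n -> l < k -> nth false (nth [::] (rows b n) k) l = b k l.
  move=> kn lk; rewrite (nth_map 0) ?size_iota // nth_iota //.
  by rewrite (nth_map 0) ?size_iota // nth_iota.
case: eqP => [->|ij]; first by rewrite b_refl.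
case: ltnP => h; first exact: nthE.
by rewrite b_sym nthE // ltn_neqAle h andbT; apply/eqP.
Qed.

(** The reverse of an order of removing traps: prefixes are again such orders, so codes can be built
    row by row. *)
Definition dismantling_order (b : rel nat) n := forall i, 0 < i < n ->
  exists2 d, d < i & forall w, w <= i -> b i w -> b d w.

Lemma capt_le_of_rows b n k : reflexive b -> symmetric b ->
  capt_le (of_rows (rows b n)) (iota 0 n) k -> capt_le b (iota 0 n) k.
Proof.
move=> b_refl b_sym; apply: (@capt_le_map _ _ _ _ id); rewrite ?map_id //.
by move=> x y; rewrite !mem_iota !add0n /=; apply: of_rowsE.
Qed.

(** A prefix that meets the bound passes it on, since the next vertex is a trap and adding a trap
    costs at most one round. Until that happens the code survives every filter. *)
Lemma slow_codesP b n k : reflexive b -> symmetric b -> dismantling_order b n ->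
  k <= n -> (4 < k) && capt_le b (iota 0 k) (k - 4) || (rows b k \in slow_codes k).
Proof.
move=> b_refl b_sym dom; elim: k => [//|k IH] kn.
have dom_k : 0 < k -> exists2 d, d < k & forall w, w <= k -> b k w -> b d w.
  by move=> k0; apply: dom; rewrite k0.
case/orP: (IH (ltnW kn)) => [/andP[k4 c]|in_k].
  have [d dk dP] := dom_k (ltn_trans (isT : 0 < 4) k4).
  apply/orP; left; rewrite ltnS (ltnW k4) subSn ?(ltnW k4) //.
  apply: (@capt_le_extend _ b b_refl b_sym k d (iota 0 k)) => //.
  - by move=> x; rewrite iota_rcons mem_rcons.
  - by rewrite mem_iota.
  - by move=> w; rewrite mem_iota /= ltnS; apply: dP.
have [//|not_fast] := boolP (_ && _).
rewrite [slow_codes k.+1]/= mem_filter; apply/andP; split; last first.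
  apply/allpairsP; exists (rows b k, [seq b k j | j <- iota 0 k]); split=> //.
    by have := mem_bitseqs [seq b k j | j <- iota 0 k]; rewrite size_map size_iota.
  exact: rowsS.
have -> : (if k is 0 then true else last_dominated (of_rows (rows b k.+1)) k) = true.
  case: k dom_k kn {IH in_k not_fast} => // k dom_k kn.
  have [d dk dP] := dom_k isT.
  rewrite /last_dominated anyE; apply/hasP; exists d; first by rewrite mem_iota.
  rewrite everyE; apply/allP => w; rewrite mem_iota /= add0n => wk.
  rewrite !of_rowsE // ?(ltn_trans dk) //.
  by case: ifP => // /dP->.
case: leqP => // k4; rewrite fast_capt_leE; apply: contra not_fast => /capt_le_of_rows h.
by rewrite h // andbT.
Qed.

Lemma capt_le_dismantling7 b : reflexive b -> symmetric b ->
  dismantling_order b 7 -> capt_le b (iota 0 7) 3.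
Proof.
move=> b_refl b_sym dom.
by have := slow_codesP b_refl b_sym dom (leqnn 7); rewrite slow_codes7 in_nil orbF.
Qed.

End SmallGraphs.

(** * Gavenciak's bound on the capture time *)

Section CaptureTime.
Variables (T : eqType) (a : rel T).
Hypotheses (a_refl : reflexive a) (a_sym : symmetric a).

Lemma capt_le_remove_trap s k : uniq s -> 1 < size s -> capt_le a s k ->
  exists u v s', [/\ perm_eq s (u :: s'), v \in s',
    forall w, w \in s -> a u w -> a v w, capt_le a s' k &
    forall l, capt_le a s' l -> capt_le a s l.+1].
Proof.
move=> s_uniq s_size c; have [u [v [us vs vu uv]]] := capt_le_trap a_refl s_uniq s_size c.
have vs' : v \in rem u s by rewrite mem_rem_uniq // inE vu.
have us' : u \notin rem u s by rewrite mem_rem_uniq // inE eqxx.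
have sE := perm_to_rem us; exists u, v, (rem u s); split=> //.
  exact: (capt_le_retract a_sym (perm_mem sE) us' vs' uv).
exact: (capt_le_extend a_refl a_sym (perm_mem sE) vs' uv).
Qed.

(** While two vertices remain there is a trap, and deleting it keeps the cop winning; the trap is
    put last and the rest is ordered by induction. *)
Lemma dismantle x0 s k : uniq s -> capt_le a s k ->
  exists xs, perm_eq s xs /\ dismantling_order (fun i j => a (nth x0 xs i) (nth x0 xs j)) (size xs).
Proof.
move: {2}(size s) (leqnn (size s)) => n; elim: n s => [|n IH] s sn s_uniq c.
  by exists s; split=> // i; move: sn; case: (s) => //= _; rewrite andbF.
have [s1|s1] := leqP (size s) 1.
  by exists s; split=> // i /andP[i0 /leq_trans/(_ s1)]; rewrite ltnNge i0.
have [u [v [s' [sE vs' uv c' _]]]] := capt_le_remove_trap s_uniq s1 c.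
have size_s := perm_size sE; rewrite /= in size_s.
have := perm_uniq sE; rewrite s_uniq => /esym/= /andP[us' s'_uniq].
have [|//|xs [s'E dom]] := IH s' _ _ c'; first by rewrite -ltnS -size_s.
exists (rcons xs u); split.
  by rewrite (perm_trans sE) // perm_sym perm_rcons perm_cons perm_sym.
move=> i; rewrite size_rcons ltnS => /andP[i0 i_le].
have [i_lt|i_ge] := ltnP i (size xs).
  have [|d di dP] := dom i; first by rewrite i0.
  exists d => // w wi; rewrite !nth_rcons i_lt (leq_ltn_trans wi) // (ltn_trans di) //.
  exact: dP.
have ->: i = size xs by apply/eqP; rewrite eqn_leq i_le.
have vxs : v \in xs by rewrite -(perm_mem s'E).
exists (index v xs); first by rewrite index_mem.
move=> w wi; rewrite [nth _ _ (size xs)]nth_rcons ltnn eqxx.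
rewrite [nth _ _ (index v xs)]nth_rcons index_mem vxs nth_index //; apply: uv.
rewrite (perm_mem sE) inE (perm_mem s'E) -in_cons -mem_rcons.
by rewrite mem_nth // size_rcons ltnS.
Qed.

(* Gavenciak's bound; deleting a trap lowers the capture time by at most one,
   which leaves only the graphs on seven vertices. *)
Lemma capt_le_sub4 s k : uniq s -> 7 <= size s -> capt_le a s k -> capt_le a s (size s - 4).
Proof.
move: {2}(size s) (leqnn (size s)) => n; elim: n s => [|n IH] s sn s_uniq s7 c.
  by have := leq_trans s7 sn.
have [s_le7|s_gt7] := leqP (size s) 7.
  have s_size : size s = 7 by apply/eqP; rewrite eqn_leq s_le7.
  have [x0 _] : exists x0, x0 \in s by case: (s) s_size => // x *; exists x; rewrite inE eqxx.
  have [xs [sE dom]] := dismantle x0 s_uniq c.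
  rewrite s_size; have xs_size : size xs = 7 by rewrite -(perm_size sE).
  rewrite xs_size in dom.
  apply: (@capt_le_map _ _ a (fun i j => a (nth x0 xs i) (nth x0 xs j)) (nth x0 xs) _ (iota 0 7)).
  - by move=> x; rewrite (perm_mem sE) -xs_size map_nth_iota0 // take_size.
  - by [].
  by apply: capt_le_dismantling7 dom => [i|i j]; [apply: a_refl|apply: a_sym].
have [u [v [s' [sE _ _ c' ext]]]] := capt_le_remove_trap s_uniq (ltn_trans (isT : 1 < 7) s_gt7) c.
have size_s := perm_size sE; rewrite /= in size_s.
have := perm_uniq sE; rewrite s_uniq => /esym/= /andP[_ s'_uniq].
rewrite size_s subSn; last by lia.
by apply/ext/IH => //; lia.
Qed.

End CaptureTime.

(** * Distances to Z, and the one-robber game inside the general one *)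

Section Game.
Variables (T : finType) (e : rel T).
Hypotheses (e_sym : symmetric e) (e_conn : forall x y : T, connect e x y).

Lemma adj_refl : reflexive (adj e).
Proof. by move=> x; rewrite /adj eqxx. Qed.

Lemma adj_sym : symmetric (adj e).
Proof. by move=> x y; rewrite /adj eq_sym e_sym. Qed.

(** [nball] extends walks at the far end, whereas the distance estimates extend them at the near
    end. *)
Lemma nballSl k x y z : adj e x y -> z \in nball e k y -> z \in nball e k.+1 x.
Proof.
move=> xy; elim: k z => [|k IH] z /=.
  by rewrite inE => /eqP->; apply/bigcupP; exists x; rewrite ?inE.
by case/bigcupP=> w /IH wx wz; apply/bigcupP; exists w.
Qed.

Lemma nballW k l x : k <= l -> nball e k x \subset nball e l x.
Proof.
move=> /subnK<-; elim: (l - k) => [//|n IH]; apply: subset_trans IH _.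
by apply/subsetP => z h; apply/bigcupP; exists z; rewrite ?inE ?adj_refl.
Qed.

(** A path without repeated vertices has fewer than [#|T|] edges, so the bounded search in [distZ]
    succeeds. *)
Lemma nball_connect x z : exists2 k, k < #|T| & z \in nball e k x.
Proof.
have /connectP[p0 p0P ->] := e_conn x z; case/shortenP: p0P => p pP p_uniq _.
exists (size p); first by have := max_card (mem (x :: p)); rewrite (card_uniqP p_uniq).
elim: p x pP {p_uniq} => [|y p IH] x /=; first by rewrite inE.
case/andP=> xy yp; apply: (@nballSl _ _ y); last exact: IH.
by rewrite /adj xy orbT.
Qed.

(** Expresses d(x,Z) <= k without the search in [distZ]. *)
Definition close (Z : {set T}) k x := exists2 z, z \in Z & z \in nball e k x.

Lemma closeW Z k l x : k <= l -> close Z k x -> close Z l x.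
Proof. by move=> kl [z zZ zx]; exists z => //; apply: (subsetP (nballW x kl)). Qed.

Lemma closeS Z k x y : adj e x y -> close Z k y -> close Z k.+1 x.
Proof. by move=> xy [z zZ zy]; exists z => //; apply: nballSl zy. Qed.

Lemma close_distZ Z x : Z != set0 -> close Z (distZ e x Z) x.
Proof.
case/set0Pn=> z zZ; have [k kT zk] := nball_connect x z.
have has_k : has (fun k => [exists z in Z, z \in nball e k x]) (iota 0 #|T|).
  by apply/hasP; exists k; [rewrite mem_iota|apply/exists_inP; exists z].
have := nth_find 0 has_k; rewrite nth_iota; last by move: has_k; rewrite has_find size_iota.
by rewrite add0n => /exists_inP[z' z'Z h]; exists z'.
Qed.

Lemma winS k C R : win e k.+1 C R <-> allcap R \/ exists C', cmoves e C C' /\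
  (allcap (capture C' R) \/
   forall R', rmoves e (capture C' R) R' -> win e k C' (capture C' R')).
Proof. by []. Qed.

(** All states have length one. A robber who steps onto the cop becomes [None] in [win], which
    matches the test [c == r] in [catches]. *)
Lemma catches_win k c r : reflect (win e k [:: c] (capture [:: c] [:: Some r]))
  (catches (adj e) (enum T) k c r).
Proof.
have caught (x y : T) : allcap (capture [:: x] [:: Some y]) = (x == y).
  by rewrite /allcap /capture /= inE andbT (eq_sym x); case: (y == x).
have free (x y : T) : x != y -> capture [:: x] [:: Some y] = [:: Some y].
  by rewrite /capture /= inE (eq_sym x) => /negbTE->.
have one_move (x y : T) : cmoves e [:: x] [:: y] = adj e x y by rewrite /cmoves /= andbT.
apply: (iffP idP); elim: k c r => [|k IH] c r.
- by rewrite catches0 -caught; left.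
- case/catchesSP => [->|[c' [_ cc' h]]]; first by left; rewrite caught eqxx.
  have [->|cr] := eqVneq c r; first by left; rewrite caught eqxx.
  right; rewrite (free _ _ cr); exists [:: c']; split; first by rewrite /cmoves /= cc'.
  have [->|c'r] := eqVneq c' r; first by left; rewrite caught eqxx.
  rewrite (free _ _ c'r); right=> -[|[r'|] [|]] //; rewrite /rmoves /= ?andbF ?andbT // => rr'.
  by case: h => [c'r'|h]; [rewrite c'r' eqxx in c'r|apply/IH/h; rewrite ?mem_enum].
- by rewrite catches0 -caught => -[].
case/winS; first by rewrite caught => /eqP->; apply: catches_refl.
have [->|cr] := eqVneq c r; first by move=> _; apply: catches_refl.
rewrite (free _ _ cr) => -[[|c' [|? ?]] [//]]; last by rewrite /cmoves /= andbF.
rewrite one_move => cc' h.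
apply/catchesSP; right; exists c'; split; rewrite ?mem_enum //.
have [|c'r] := eqVneq c' r; [by left|right=> r' _ rr'; apply: IH].
case: h => [|h]; first by rewrite caught (negbTE c'r).
by apply: h; rewrite (free _ _ c'r) /rmoves /= rr'.
Qed.

Lemma cop_start_win_byP v t :
  reflect (cop_start_win_by e v t) (all (catches (adj e) (enum T) t v) (enum T)).
Proof.
apply: (iffP allP) => h r; last by move=> _; apply/catches_win.
by apply/catches_win/h; rewrite mem_enum.
Qed.

Lemma cop_win_capt_le : cop_win e -> exists t, capt_le (adj e) (enum T) t.
Proof.
case=> t [C h]; exists t; case/tupleP: C h => c C; rewrite (tuple0 C) => h.
apply/hasP; exists c; rewrite ?mem_enum //; apply/cop_start_win_byP => r.
exact: (h [tuple r]).
Qed.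

Lemma win_mono s t C R : s <= t -> win e s C R -> win e t C R.
Proof.
elim: s t C R => [|s IH] [|t] C R //=; [by move=> _ []; [left|]|].
rewrite ltnS => st [|[C' [CC' h]]]; [by left|right; exists C'; split=> //].
by case: h => [|h]; [left|right=> R' RR'; apply: IH st _; apply: h].
Qed.

(** * Several robbers: counting the active ones, and walking *)

Definition active (R : seq (option T)) := count isSome R.

Lemma active_capture C R : active (capture C R) <= active R.
Proof.
elim: R => //= -[v|] R IH /=; last by rewrite add0n.
by apply: leq_add => //; case: ifP.
Qed.

Lemma active_capture_lt C R i r : nth None R i = Some r -> r \in C ->
  active (capture C R) < active R.
Proof.
move=> + rC; elim: R i => [|x R IH] [|i] //=.
  by move=> ->; rewrite rC /= ltnS active_capture.
move=> /IH lt; rewrite -addnS; apply: leq_add => //.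
by case: x => // v; case: ifP.
Qed.

Lemma active_rmoves R R' : rmoves e R R' -> active R' = active R.
Proof.
by elim: R R' => [|[x|] R IH] [|[y|] R'] //= => [/andP[_ /IH->]|/IH->].
Qed.

Lemma active0 R : (active R == 0) = allcap R.
Proof. by elim: R => [//|[x|] R IH]; [|apply: IH]. Qed.

Lemma nth_capture (C : seq T) R i r : nth None (capture C R) i = Some r <->
  nth None R i = Some r /\ r \notin C.
Proof.
rewrite /capture; have [iR|iR] := ltnP i (size R); last first.
  by rewrite !nth_default ?size_map //; split=> [//|[]].
rewrite (nth_map None) //; case: (nth None R i) => [v|]; last by split=> [|[]].
case: ifP => vC; split=> //; first by case=> -[<-]; rewrite vC.
  by case=> <-; rewrite vC.
by case.
Qed.

Lemma nth_rmoves R R' i r : rmoves e R R' -> nth None R i = Some r ->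
  exists2 r', nth None R' i = Some r' & adj e r r'.
Proof.
elim: R R' i => [|x R IH] [|y R'] [|i] //=.
  by move=> /andP[xy _] xr; move: xy; rewrite xr; case: y => // r' rr'; exists r'.
by move=> /andP[_ /IH]; apply.
Qed.

(** The induction peels off the last step of the walk. Captures on the way only lower the number of
    active robbers, so the assumption at [z] still applies. *)
Lemma walk k t x z n : z \in nball e k x ->
  (forall R, active R <= n -> win e t [:: z] (capture [:: z] R)) ->
  forall R, active R <= n -> win e (k + t) [:: x] (capture [:: x] R).
Proof.
elim: k t z => [|k IH] t z; first by rewrite inE => /eqP->.
case/bigcupP=> y yx; rewrite inE => yz h; rewrite addSnnS; apply: IH yx _ => R Rn.
right; exists [:: z]; rewrite /cmoves /= yz; split=> //; right=> R' RR'.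
apply: h; rewrite (active_rmoves RR') (leq_trans (active_capture _ _)) //.
by rewrite (leq_trans (active_capture _ _)).
Qed.

(** * Catching the robbers one after the other *)

Section Pursuit.
Variables (Z : {set T}) (dZ N : nat).
Hypothesis Z_catches : forall z r, z \in Z -> catches (adj e) (enum T) N z r.
Hypothesis trap_close : forall u x, is_trap e u -> adj e u x -> close Z dZ x.
Hypothesis N_gt1 : 1 < N.

Lemma catches_close k c r : c != r ->
  (forall r', adj e r r' -> catches (adj e) (enum T) k c r') ->
  forall x, adj e r x -> close Z (dZ + k.-1) x.
Proof.
elim: k c r => [|k IH] c r cr h x rx.
  by have := h r (adj_refl r); rewrite catches0 (negbTE cr).
have [dom|] := boolP (cnbhd e r \subset cnbhd e c).
  apply: (@closeW _ dZ); first exact: leq_addr.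
  by apply: trap_close rx; apply/existsP; exists c; rewrite cr.
case/subsetPn=> y; rewrite !inE => ry cy.
case/catchesSP: (h y ry) => [ycE|[c' [_ cc' h']]]; first by rewrite ycE adj_refl in cy.
have c'y : c' != y by apply: contraNneq cy => <-.
have {}h' r' : adj e y r' -> catches (adj e) (enum T) k c' r'.
  by case: h' => [/eqP|h' yr']; [rewrite (negbTE c'y)|apply: h'; rewrite ?mem_enum].
case: k h' {IH h} (IH c' y c'y) => [|k] h' IH.
  by have := h' y (adj_refl y); rewrite catches0 (negbTE c'y).
(* As [r] is itself a neighbour of [y], the induction bounds its distance to Z; passing on to [x]
   costs one step, not two. *)
rewrite /= addnS; apply: (closeS (y := r)); first by rewrite adj_sym.
by apply: IH => //; rewrite adj_sym.
Qed.

(** The cop follows the fixed robber [i], with [k] rounds for him and [N + dZ] for each of the [j]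
    others. The last hypothesis covers a capture by her next move; [catches_close] takes over
    afterwards. *)
Lemma pursue j k c R i r :
  (forall z S, z \in Z -> active S <= j ->
     win e (j * N + j.-1 * dZ) [:: z] (capture [:: z] S)) ->
  nth None R i = Some r -> c != r -> active R <= j.+1 ->
  catches (adj e) (enum T) k c r -> (adj e c r -> close Z (dZ + k.-1) r) ->
  win e (k + j * (N + dZ)) [:: c] R.
Proof.
move=> next; have caught k' x S : close Z (dZ + k') x -> active (capture [:: x] S) <= j ->
    win e (k' + j * (N + dZ)) [:: x] (capture [:: x] S).
  move=> x_close Sj; have [|S0] := boolP (allcap (capture [:: x] S)).
    by case: (k' + _) => [|n] ?; left.
  (* Now [j.-1] is a true predecessor, and a walk of [dZ + k'] rounds followed by
     [j * N + j.-1 * dZ] uses exactly the budget. *)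
  have j0 : 0 < j by apply: leq_trans Sj; rewrite lt0n active0.
  have [z zZ zx] := x_close.
  have := walk zx (fun R => next z R zZ) Sj.
  have -> : capture [:: x] (capture [:: x] S) = capture [:: x] S.
    by rewrite /capture -map_comp; apply: eq_map => -[v|] //=; case: ifP => //= ->.
  by apply: win_mono; nia.
elim: k c R r => [|k IH] c R r Ri cr Rj; first by rewrite catches0 (negbTE cr).
case/catchesSP => [/eqP|[c' [_ cc' h]]]; first by rewrite (negbTE cr).
move=> r_close; rewrite addSn; right; exists [:: c']; rewrite /cmoves /= cc'; split=> //.
right=> R' RR'; have R'E := active_rmoves RR'.
have R'j : active R' <= j.+1 by rewrite R'E (leq_trans (active_capture _ _)).
(* A capture by the cop's own move: the robber's distance to Z is known from [r_close]. *)
have [c'r|c'r] := eqVneq c' r.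
  rewrite c'r; apply: caught; first by apply: r_close; rewrite -c'r.
  rewrite -ltnS (leq_ltn_trans (active_capture _ _)) // R'E (leq_trans _ Rj) //.
  by apply: active_capture_lt Ri _; rewrite c'r inE.
have {}h r' : adj e r r' -> catches (adj e) (enum T) k c' r'.
  by case: h => [/eqP|h rr']; [rewrite (negbTE c'r)|apply: h; rewrite ?mem_enum].
have [|r' R'i rr'] := nth_rmoves (i := i) (r := r) RR'.
  by apply/nth_capture; rewrite inE eq_sym.
have r'_close := catches_close c'r h rr'.
(* The robber may step onto the cop; otherwise [r'_close] becomes the hypothesis on captures for the
   next round. *)
have [c'r'|c'r'] := eqVneq c' r'.
  rewrite c'r'; apply: caught; first by apply: closeW r'_close; rewrite leq_add2l leq_pred.
  by rewrite -ltnS (leq_trans _ R'j) //; apply: active_capture_lt R'i _; rewrite inE.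
apply: (IH _ _ r') => //; last exact: h.
- by apply/nth_capture; rewrite inE eq_sym.
- exact: leq_trans (active_capture _ _) R'j.
Qed.

Lemma win_from_Z j z R : z \in Z -> active R <= j ->
  win e (j * N + j.-1 * dZ) [:: z] (capture [:: z] R).
Proof.
elim: j z R => [|j IH] z R zZ Rj.
  by left; rewrite -active0 -leqn0 (leq_trans (active_capture _ _)).
have [|] := boolP (allcap (capture [:: z] R)); first by case: (_ + _) => [|n] ?; left.
rewrite -has_predC => /hasP[[r|] // rR _].
have [i _ Ri] := nthP None rR.
have zr : z != r by have /nth_capture[_] := Ri; rewrite inE eq_sym.
have -> : j.+1 * N + j.+1.-1 * dZ = N + j * (N + dZ) by rewrite /=; nia.
apply: (pursue IH Ri zr) => //; first exact: leq_trans (active_capture _ _) Rj.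
  exact: Z_catches.
(* A robber caught by the first move is adjacent to [z] in Z, and 1 <= dZ + (N - 1) because
   [N > 1]. *)
move=> zr_adj; apply: (@closeW _ 1); first by lia.
by apply: (closeS (y := z)); [rewrite adj_sym|exists z; rewrite ?inE].
Qed.

End Pursuit.
End Game.

(** * The optimal round and the final bound *)

(** Serves to define the capture time: [cops_win_by] is a proposition, so excluded middle decides
    whether a smaller round exists. *)
Lemma least_nat (P : nat -> Prop) n : P n -> exists c, [/\ P c, forall t, P t -> c <= t & c <= n].
Proof.
elim/ltn_ind: n => n IH Pn.
have [[k [kn Pk]]|none] := classic (exists k, k < n /\ P k).
  by have [c [Pc c_min ck]] := IH _ kn Pk; exists c; split=> //; apply: leq_trans (ltnW kn).
by exists n; split=> // t Pt; rewrite leqNgt; apply/negP => tn; apply: none; exists t.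
Qed.

Theorem mainTheorem3 (T : finType) (e : rel T)
  (e_sym : symmetric e) (e_irr : irreflexive e)
  (e_conn : forall x y : T, connect e x y)
  (Hcw : cop_win e) (Hn : 7 <= #|T|)
  (Z : {set T})
  (HZ : forall v : T, v \in Z <-> cop_start_win_by e v (#|T| - 4))
  (dZ : nat)
  (HdZ : dZ = \max_(u : T | is_trap e u) \max_(x in cnbhd e u) distZ e x Z)
  (m : nat) (Hm : 1 <= m) :
  exists c, is_capt e 1 m c /\ c <= dZ * (m - 1) + m * (#|T| - 4).
Proof.
(* Gavenciak's bound provides a vertex [z] of Z, where the cop will start. *)
have [t0 /(capt_le_sub4 (adj_refl e) (adj_sym e_sym) (enum_uniq T))] := cop_win_capt_le Hcw.
rewrite -cardE => /(_ Hn)/hasP[z _ /cop_start_win_byP/HZ zZ].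
have Z_catches v r : v \in Z -> catches (adj e) (enum T) (#|T| - 4) v r.
  by move=> /HZ/cop_start_win_byP/allP; apply; rewrite mem_enum.
have trap_close u x : is_trap e u -> adj e u x -> close e Z dZ x.
  move=> u_trap ux; apply: (@closeW _ _ _ (distZ e x Z)); last first.
    by apply: close_distZ => //; apply/set0Pn; exists z.
  rewrite HdZ (bigmax_sup u) // (bigmax_sup x) // inE //.
have capt : cops_win_by e 1 m (dZ * (m - 1) + m * (#|T| - 4)).
  exists [tuple z] => R; rewrite addnC mulnC subn1 [dZ * _]mulnC [_ * m]mulnC.
  apply: (win_from_Z e_sym Z_catches trap_close) => //; first by lia.
  by rewrite /active (leq_trans (count_size _ _)) // size_map size_tuple.
have [c [c_capt c_min c_le]] := least_nat capt.
by exists c; split.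
Qed.
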